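(* Let $x$ be a nonempty modified ascent sequence, and let $\mathrm{flip}(x)$ denote the modified ascent sequence that corresponds to the Fishburn matrix $\mathrm{flip}(A)$, where $A=(\beta\circ\bar\alpha)(x)$; that is, $\mathrm{flip}(x)$ is the modified ascent sequence with $(\beta\circ\bar\alpha)(\mathrm{flip}(x))=\mathrm{flip}(A)$. Then $$\mathrm{flip}(x)=\alpha\bigl(\mathrm{flip}(\mathfrak{P}(x))\bigr),$$ where $\alpha$ is the map from Fishburn covers to modified ascent sequences given by the block-insertion procedure.
   Context: Write $[k]=\{1,\dots,k\}$. Trees. A binary tree is either empty or a triple $T=(L,r,R)$ with $r$ a node (the root) and $L,R$ binary trees. $V(T)$ is the set of nodes and the size of $T$ is $|V(T)|$. A vertex labeling is a map $\mathfrak{l}:V(T)\to\{1,2,\dots\}$; $\max(T)$ is the largest label, $\max(\emptyset)=0$. Labeled trees are considered up to label-preserving isomorphism. $T$ is decreasing if it is empty, or $L,R$ are decreasing and $\mathfrak{l}(r)\ge\max\{\max(L),\max(R)\}$; strictly decreasing to the left if it is empty, or $\mathfrak{l}(r)>\max(L)$ and $L,R$ are strictly decreasing to the left. An endotree of size $n$ is a decreasing binary tree of size $n$ that is strictly decreasing to the left with all labels in $[n]$; it is regular if its label set is $[k]$ for some $k\le n$. Let $v_i$ be the $i$-th node visited in the in-order traversal (left subtree, root, right subtree). $\mathrm{asctops}(T)=\{v_1\}\cup\{v_i:v_i\text{ has a left child}\}$, $\mathrm{nub}(T)=\{v_j:\mathfrak{l}(v_i)\ne\mathfrak{l}(v_j)\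 \forall i<j\}$. A Fishburn tree is a regular endotree with $\mathrm{nub}(T)=\mathrm{asctops}(T)$. Paths and covers. A maximal right path is a nonempty sequence of nodes, each the right child of the previous one, whose first node is not a right child and whose last node has no right child; maximal left paths are analogous. $\mathrm{rpath}(v)$ is the maximal right path containing $v$; $\mathrm{diag}(T)$ is the maximal left path containing the root. For a Fishburn tree $T$ with $k=\max(T)$, $\mathrm{asctops}(T)$ has exactly one node of each label $i\in[k]$; if $v$ is that node, $W_i=\mathrm{rpath}(v)$ if $v\in\mathrm{diag}(T)$ and $W_i=\mathrm{rpath}(\text{left child of }v)$ otherwise. Let $B_i$ be the multiset of labels of nodes of $W_i$ and $\mathfrak{P}(T)=B_1\dots B_k$. This is a Fishburn cover, i.e. a list of $k$ nonempty multisets whose elements form exactly the set $[k]$ and such that $j\in B_i$ implies $j\le i$. Sequences. A Cayley permutation is a word $x=x_1\dots x_n$ whose set of values is $[k]$ for some $k$. A modified ascent sequence is a Cayley permutation $x$ with $\mathrm{asctops}(x)=\mathrm{nub}(x)$, where $\mathrm{asctops}(x)=\{(1,x_1)\}\cup\{(i,x_i):1<i\le n,\,x_{i-1}<x_i\}$ and $\mathrm{nub}(x)=\{(\min x^{-1}(j),j):1\le j\le\max(x)\}$. For a word $x$ of positive integers, $\bar\alpha(x)$ is the empty tree if $x$ is empty; otherwise, with $m$ the index of the leftmost maximum of $x$, $\bar\alpha(x)$ has root labeled $x_m$, left subtree $\bar\alpha(x_1\dots x_{m-1})$ and right subtree $\bar\alpha(x_{m+1}\dots x_n)$. It restricts to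 a bijection from modified ascent sequences to Fishburn trees, whose inverse is the in-order sequence. Put $\mathfrak{P}(x)=\mathfrak{P}(\bar\alpha(x))$. Matrices. A Fishburn matrix is a lower triangular square matrix with nonnegative integer entries and no zero row or column. For a Fishburn tree $T$ with $k=\max(T)$, $\beta(T)$ is the $k\times k$ matrix whose $(i,j)$-entry is the number of nodes with label $j$ in $W_i$; $\beta$ is a bijection from Fishburn trees to Fishburn matrices. For a $k\times k$ matrix $A=(a_{i,j})$, $\mathrm{flip}(A)(i,j)=a_{k+1-j,k+1-i}$; the flip of a Fishburn matrix is a Fishburn matrix. Flip of covers. A Fishburn cover $P=B_1\dots B_k$ is identified with the multiset of columns $\binom{i}{j}$, one for each $j\in B_i$ (with multiplicity). $\mathrm{flip}(P)$ is the cover obtained by replacing each column $\binom{i}{j}$ with $\binom{k+1-j}{k+1-i}$. The map $\alpha$ on covers (block-insertion procedure). Let $P=B_1\dots B_k$ be a Fishburn cover and let $\overrightarrow{B_i}$ be the word listing the elements of $B_i$ in weakly decreasing order. Let $\{i\in[k]:i\in B_i\}=\{i_1<\dots<i_p\}$ and $\{i\in[k]:i\notin B_i\}=\{j_1>\dots>j_q\}$. Let $x^{(0)}=\overrightarrow{B_{i_1}}\,\overrightarrow{B_{i_2}}\dots\overrightarrow{B_{i_p}}$ (concatenation), and for $s=1,\dots,q$ let $x^{(s)}$ be obtained from $x^{(s-1)}$ by inserting $\overrightarrow{B_{j_s}}$ immediately before the leftmost occurrence of the integer $j_s$. Then $\alpha(P)=x^{(q)}$. *)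

(* Defs.v *)
From mathcomp Require Import all_boot all_algebra.
From mathcomp Require Import finmap multiset zify.

Set Implicit Arguments.
Unset Strict Implicit.
Unset Printing Implicit Defensive.

Local Open Scope nat_scope.
Local Open Scope mset_scope.

Definition maxs (x : seq nat) : nat := \max_(a <- x) a.

Definition cayley (x : seq nat) : Prop :=
  exists k, forall a, (a \in x) = (1 <= a <= k).

(* Positions in words are numbered from 1, as are labels and blocks below. *)
Definition asctops_seq (x : seq nat) : seq (nat * nat) :=
  [seq (i.+1, nth 0 x i) |
     i <- iota 0 (size x) & (i == 0) || (nth 0 x i.-1 < nth 0 x i)].

Definition nub_seq (x : seq nat) : seq (nat * nat) :=
  [seq ((index a x).+1, a) | a <- iota 1 (maxs x)].

Definition modified_ascent (x : seq nat) : Prop :=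
  cayley x /\ asctops_seq x =i nub_seq x.

Inductive tree : Type := Empty | Node of tree & nat & tree.

(* A node is its address from the root: [false] goes left, [true] goes right. *)
Definition node := seq bool.

Fixpoint inorder (T : tree) : seq node :=
  if T is Node L _ R then
    map (cons false) (inorder L) ++ [::] :: map (cons true) (inorder R)
  else [::].

Fixpoint subtree (T : tree) (v : node) : tree :=
  match v, T with
  | [::], _ => T
  | b :: v', Node L _ R => subtree (if b then R else L) v'
  | _ :: _, Empty => Empty
  end.

Definition label (T : tree) (v : node) : nat :=
  if subtree T v is Node _ a _ then a else 0.

Definition maxT (T : tree) : nat := \max_(v <- inorder T) label T v.

Definition asctops (T : tree) : seq node :=
  [seq v <- inorder T |
     (v == head [::] (inorder T)) || (rcons v false \in inorder T)].

(* The direction [b] is [true] for right paths and [false] for left paths. *)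
Definition is_max_path (b : bool) (T : tree) (s : seq node) : Prop :=
  [/\ s != [::],
      {subset s <= inorder T},
      sorted (fun u v => v == rcons u b) s,
      forall u, head [::] s <> rcons u b
    & rcons (last [::] s) b \notin inorder T].

(* [v] without its longest suffix of steps [b] *)
Fixpoint path_top (b : bool) (v : node) : node :=
  if v is c :: v' then
    if all (pred1 b) v then [::] else c :: path_top b v'
  else [::].

Fixpoint spine (b : bool) (T : tree) : seq node :=
  if T is Node L _ R then
    [::] :: map (cons b) (if b then spine b R else spine b L)
  else [::].

Definition max_path (b : bool) (T : tree) (v : node) : seq node :=
  let t := path_top b v in map (cat t) (spine b (subtree T t)).

Definition rpath (T : tree) (v : node) : seq node := max_path true T v.

Definition diag (T : tree) : seq node := max_path false T [::].

(* The node of label [i] in [asctops T], which is unique when [T] is a Fishburn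
   tree and [1 <= i <= maxT T]. *)
Definition asctop (T : tree) (i : nat) : node :=
  head [::] [seq v <- asctops T | label T v == i].

Definition W (T : tree) (i : nat) : seq node :=
  let v := asctop T i in
  if v \in diag T then rpath T v else rpath T (rcons v false).

(* A cover [B_1 ... B_k] is the list of its blocks; [block P i] is [B_i]. *)
Definition cover := seq {mset nat}.

Definition block (P : cover) (i : nat) : {mset nat} := nth mset0 P i.-1.

Definition cover_of_tree (T : tree) : cover :=
  [seq seq_mset [seq label T v | v <- W T i] | i <- iota 1 (maxT T)].

(* Square matrices are bundled with their size, because the size of [beta T]
   depends on [T].  The row and column of number [i] have index [i - 1]. *)
Definition sqmatrix := {k : nat & 'M[nat]_k}.

Definition beta (T : tree) : sqmatrix :=
  existT _ (maxT T)
    (\matrix_(i < maxT T, j < maxT T)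
       count (fun v => label T v == j.+1) (W T i.+1))%R.

(* [rev_ord] is [i |-> k + 1 - i] for the numbering from 1. *)
Definition flip_matrix (A : sqmatrix) : sqmatrix :=
  existT _ (projT1 A)
    (\matrix_(i < projT1 A, j < projT1 A) projT2 A (rev_ord j) (rev_ord i))%R.

(* the pair [(i, j)] is the column with [i] on top of [j] *)
Definition columns (P : cover) : {mset nat * nat} :=
  seq_mset (flatten [seq [seq (i, j) | j <- (block P i : seq nat)]
                    | i <- iota 1 (size P)]).

Definition cover_of_columns (k : nat) (C : {mset nat * nat}) : cover :=
  [seq seq_mset [seq c.2 | c <- (C : seq (nat * nat)) & c.1 == i]
  | i <- iota 1 k].

Definition flip_cover (P : cover) : cover :=
  let k := size P in
  cover_of_columns k
    (seq_mset [seq (k.+1 - c.2, k.+1 - c.1)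
              | c <- (columns P : seq (nat * nat))]).

(* [n] bounds the recursion depth; see [baralphaE]. *)
Fixpoint baralpha_rec (n : nat) (x : seq nat) : tree :=
  match n, x with
  | n'.+1, _ :: _ =>
      let m := index (maxs x) x in
      Node (baralpha_rec n' (take m x)) (maxs x) (baralpha_rec n' (drop m.+1 x))
  | _, _ => Empty
  end.

Definition baralpha (x : seq nat) : tree := baralpha_rec (size x) x.

Definition arrow (B : {mset nat}) : seq nat := sort geq (B : seq nat).

Definition insert_before (a : nat) (w x : seq nat) : seq nat :=
  take (index a x) x ++ w ++ drop (index a x) x.

Definition alpha (P : cover) : seq nat :=
  let I := [seq i <- iota 1 (size P) | i \in block P i] in
  let J := rev [seq j <- iota 1 (size P) | j \notin block P j] in
  foldl (fun x j => insert_before j (arrow (block P j)) x)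
        (flatten [seq arrow (block P i) | i <- I]) J.

(* The relation [y = flip(x)]: the word flip(x) is specified by its matrix. *)
Definition is_flip (x y : seq nat) : Prop :=
  modified_ascent y /\ beta (baralpha y) = flip_matrix (beta (baralpha x)).

Lemma maxs_mem x : x != [::] -> maxs x \in x.
Proof.
rewrite /maxs; elim: x => // a x IH _; rewrite big_cons inE.
case: x IH => [|b x] IH; first by rewrite big_nil maxn0 eqxx.
have := IH isT; set M := \big[_/_]_(_ <- _) _ => hM.
by case: (leqP a M) => h; rewrite ?eqxx ?hM ?orbT.
Qed.

Lemma baralpha_rec_enough n x :
  size x <= n -> baralpha_rec n x = baralpha_rec (size x) x.
Proof.
move: {2}(size x) (leqnn (size x)) => s; elim: s n x => [|s IH] n x hs hn.
  by case: x hs {hn} => // _; case: n.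
case: x hs hn => [|a x] hs hn; first by case: n hn.
case: n hn => // n hn; rewrite /= !ltnS in hs hn *.
have hm : index (maxs (a :: x)) (a :: x) <= size x.
  by rewrite -ltnS -[(size x).+1]/(size (a :: x)) index_mem maxs_mem.
set m := index _ _ in hm *.
have ht : size (take m (a :: x)) <= size x by rewrite size_take /=; case: ltnP => //; lia.
have hd : size (drop m x) <= size x by rewrite size_drop leq_subr.
congr Node; rewrite (IH n) ?[RHS](IH (size x)) //.
all: by first [exact: (leq_trans ht) | exact: (leq_trans hd)].
Qed.

Lemma baralphaE x : x != [::] ->
  let m := index (maxs x) x in
  baralpha x = Node (baralpha (take m x)) (maxs x) (baralpha (drop m.+1 x)).
Proof.
case: x => // a x _ /=.
have hm : index (maxs (a :: x)) (a :: x) <= size x.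
  by rewrite -ltnS -[(size x).+1]/(size (a :: x)) index_mem maxs_mem.
rewrite /baralpha /=; set m := index _ _ in hm *.
congr Node; apply: baralpha_rec_enough.
- by apply: leq_trans hm; rewrite size_take_min geq_minl.
- by rewrite size_drop leq_subr.
Qed.

Lemma subtree_cat T u v : subtree T (u ++ v) = subtree (subtree T u) v.
Proof. by elim: u T => [|b u IH] [|L a R] //=; case: {IH} v. Qed.

Lemma mem_inorder T v :
  (v \in inorder T) = (if subtree T v is Node _ _ _ then true else false).
Proof.
elim: T v => [|L IHL a R IHR] [|b v] //=; rewrite mem_cat inE.
  by rewrite orbT.
have inj c : injective (cons c : seq bool -> _) by move=> ? ? [].
have no (c d : bool) (w : node) s : c != d -> (c :: w \in map (cons d) s) = false.
  by move=> cd; apply/mapP => -[u _ [ecd _]]; rewrite ecd eqxx in cd.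
by case: b; rewrite ?(no true false) ?(no false true) //= mem_map ?IHL ?IHR ?orbF.
Qed.

Lemma spineE b T : spine b T = [seq nseq i b | i <- iota 0 (size (spine b T))].
Proof.
elim: T => //= L IHL a R IHR; rewrite size_map; congr cons.
rewrite -[1]addn0 iotaDl -map_comp (@eq_map _ _ _ (cons b \o nseq^~ b)) //.
by rewrite map_comp; case: b IHL IHR => [_ <-|<- _].
Qed.

Lemma mem_spine b T i : (nseq i b \in inorder T) = (i < size (spine b T)).
Proof.
rewrite mem_inorder; elim: T i => [|L IHL a R IHR] [|i] //=.
by rewrite size_map ltnS; case: b IHL IHR => [_ <-|<- _].
Qed.

Lemma path_topE b v : exists i, v = path_top b v ++ nseq i b.
Proof.
elim: v => [|c v [i IH]]; first by exists 0.
rewrite /=; case: ifP => [/andP[/eqP-> /all_pred1P->]|_].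
  by exists (size v).+1.
by exists i; rewrite /= -IH.
Qed.

Lemma path_top_last b v u : path_top b v <> rcons u b.
Proof.
elim: v u => [|c v IH] [|d u] //=; case: ifP => // hall; last first.
  by case=> _ /IH.
case=> cb E; move: hall; have [i ->] := path_topE b v.
by rewrite E cb /= eq_refl all_nseq /= eq_refl orbT.
Qed.

Lemma max_pathE b T v :
  max_path b T v =
  [seq path_top b v ++ nseq i b |
     i <- iota 0 (size (spine b (subtree T (path_top b v))))].
Proof. by rewrite /max_path {1}spineE -map_comp. Qed.

Lemma mem_max_path_top b T t i :
  (t ++ nseq i b \in inorder T) = (i < size (spine b (subtree T t))).
Proof. by rewrite mem_inorder subtree_cat -mem_inorder mem_spine. Qed.

Lemma cat_nseqS (b : bool) t i : t ++ nseq i.+1 b = rcons (t ++ nseq i b) b.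
Proof. by rewrite -addn1 nseqD catA cats1. Qed.

Lemma sorted_nseq (b : bool) t s :
  path (fun u v => v == rcons u b) t s ->
  t :: s = [seq t ++ nseq i b | i <- iota 0 (size s).+1].
Proof.
elim: s t => [|u s IH] t; first by rewrite /= cats0.
case/andP=> /eqP-> /IH eqs; rewrite [X in t :: X]eqs -[(size (_ :: s)).+1]/(1 + (size s).+1).
rewrite iotaD (addnC 0) iotaDl map_cat -map_comp [map _ (iota 0 1)]/= cats0.
by congr cons; apply: eq_map => i /=; rewrite -cats1 -catA.
Qed.

Lemma path_top_id b t i :
  (forall u, t <> rcons u b) -> path_top b (t ++ nseq i b) = t.
Proof.
elim: t => [|c t IH] ht /=.
  by case: i => //= i; rewrite eq_refl all_nseq /= eq_refl orbT.
rewrite all_cat all_nseq /= eq_refl orbT andbT; case: ifP => [|_].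
  case/andP=> /eqP ec /all_pred1P et; case: (ht (nseq (size t) b)).
  by rewrite ec [in LHS]et; elim: (size t) => //= p ->.
by rewrite IH // => u eu; apply: (ht (c :: u)); rewrite eu.
Qed.

(* [max_path b T v] is the unique maximal path in direction [b] containing [v]. *)
Lemma max_pathP b T v (s : seq node) : v \in inorder T ->
  is_max_path b T s /\ v \in s <-> s = max_path b T v.
Proof.
move=> vT; split=> [[[s0 sT ssrt shd slst] vs]|->].
  case: s => // t s in s0 sT ssrt shd slst vs *.
  have es := sorted_nseq ssrt; rewrite /= in shd.
  have tv : path_top b v = t.
    by move: vs; rewrite es => /mapP[i _ ->]; exact: path_top_id.
  rewrite max_pathE tv es; congr (map _ (iota 0 _)).
  have el : last [::] (t :: s) = t ++ nseq (size s) b.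
    by rewrite -nth_last es (nth_map 0) size_map size_iota ?nth_iota.
  move: slst; rewrite el -cat_nseqS mem_max_path_top -leqNgt => le1.
  apply/eqP; rewrite eqn_leq le1 andbT -mem_max_path_top -el.
  by apply: sT; rewrite /= mem_last.
have [i vi] := path_topE b v; rewrite max_pathE.
move: (path_top_last (b := b) (v := v)) vi; set t := path_top b v => ht vi.
set n := size _; have lt_in : i < n by rewrite -mem_max_path_top -vi.
case En: n => [|m]; first by rewrite En in lt_in.
split; last first.
  by apply/mapP; exists i => //; rewrite mem_iota -En.
split=> //.
- by move=> u /mapP[j]; rewrite mem_iota -En => jn ->; rewrite mem_max_path_top.
- apply: (@homo_sorted _ _ _ (fun j k => k == j.+1)).
    by move=> j k /eqP->; rewrite cat_nseqS.
  by elim: m.+1 0 => // p IHp q; case: p IHp => //= p /(_ q.+1)->; rewrite eqxx.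
- by rewrite /= cats0.
have -> : last [::] [seq t ++ nseq j b | j <- iota 0 m.+1] = t ++ nseq m b.
  by rewrite -nth_last size_map size_iota (nth_map 0) ?size_iota // nth_iota.
by rewrite -cat_nseqS mem_max_path_top -/n En ltnn.
Qed.

(* Main.v *)
Require Import Defs.
From mathcomp Require Import all_boot all_algebra.
From mathcomp Require Import finmap multiset zify.

(* In the in-order word [x] of [baralpha x], the labels along the right spine are the
   weak right-to-left maxima of [x]; reading [x] from left to right, they form a
   stack from which a new letter [a] pops the labels smaller than [a]. If [a] is
   not a record, the labels popped at its first occurrence are the block [B_a]; if
   [a] is a record, they are the block of the preceding record. So the cover of
   [x] can be read on the word itself. Each block insertion adds one block to the
   cover and disturbs no other one, so that [alpha P] has the cover [P]; and a
   modified ascent sequence is determined by its cover, because the stack can be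
   run backwards. The flip only transposes the multiplicities of the cover. *)

Set Implicit Arguments.
Unset Strict Implicit.
Unset Printing Implicit Defensive.

Local Open Scope nat_scope.

(** * Words *)

Lemma filter_nil (T : eqType) (p : pred T) s :
  {in s, forall c, ~~ p c} -> filter p s = [::].
Proof. by move=> h; rewrite -(filter_pred0 s); apply: eq_in_filter => c /h/negbTE. Qed.

(* These are the labels along the right spine of [baralpha x]. *)
Fixpoint rlmax (x : seq nat) : seq nat :=
  if x is a :: x' then
    if all (geq a) x' then a :: rlmax x' else rlmax x'
  else [::].

Lemma rlmax_cat u v :
  rlmax (u ++ v) = [seq c <- rlmax u | all (geq c) v] ++ rlmax v.
Proof.
elim: u => //= a u IH; rewrite all_cat; case: (all (geq a) u) => //=.
by rewrite IH; case: ifP.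
Qed.

Lemma rlmax_rcons u a : rlmax (rcons u a) = rcons [seq c <- rlmax u | a <= c] a.
Proof.
rewrite -cats1 rlmax_cat /= cats1; congr rcons.
by apply: eq_filter => c; rewrite /= andbT.
Qed.

Lemma mem_rlmax u a : a \in rlmax u -> a \in u.
Proof.
elim: u => //= b u IH; case: ifP => _; rewrite !inE.
  by case/orP=> [->//|/IH->]; rewrite orbT.
by move/IH->; rewrite orbT.
Qed.

Lemma rlmax_eq0 u : (rlmax u == [::]) = (u == [::]).
Proof.
by case/lastP: u => // u a; rewrite rlmax_rcons -!size_eq0 !size_rcons.
Qed.

Lemma last_rlmax c u : last c (rlmax u) = last c u.
Proof. by case/lastP: u => // u a; rewrite rlmax_rcons !last_rcons. Qed.

Lemma rlmax_ge u c : c \in rlmax u -> last 0 u <= c.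
Proof.
case/lastP: u => // u a.
by rewrite rlmax_rcons last_rcons mem_rcons inE mem_filter => /orP[/eqP->|/andP[]].
Qed.

Lemma sorted_rlmax u : sorted geq (rlmax u).
Proof.
elim: u => //= a u IH; case: ifP => // h.
rewrite /= path_min_sorted //; apply/allP => c /mem_rlmax cu.
exact: (allP h).
Qed.

Lemma geq_trans : transitive geq.
Proof. by move=> b a c /= h1 h2; exact: leq_trans h2 h1. Qed.

Lemma rlmax_id w : sorted geq w -> rlmax w = w.
Proof.
elim: w => //= a w IH h; rewrite IH ?(path_sorted h) //.
by rewrite (order_path_min geq_trans h).
Qed.

(** The letter [a] pops all of [w], and whatever [w] pops from the stack of [u] is smaller than [a],
    so [a] would pop it as well. *)
Lemma rlmax_absorb u w a v :
  all (gtn a) w -> rlmax (u ++ w ++ a :: v) = rlmax (u ++ a :: v).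
Proof.
move=> wa.
have h s : rlmax (s ++ a :: v) = [seq c <- rlmax (rcons s a) | all (geq c) v] ++ rlmax v.
  by rewrite -cat_rcons rlmax_cat.
rewrite catA !h; congr (filter _ _ ++ _); rewrite !rlmax_rcons rlmax_cat filter_cat.
rewrite -filter_predI; congr rcons.
rewrite [X in _ ++ X](_ : _ = [::]) ?cats0; last first.
  apply: filter_nil => c /mem_rlmax cw.
  by rewrite -ltnNge; exact: (allP wa).
apply: eq_in_filter => c _ /=; case: leqP => //= ac.
by apply/allP => b bw /=; exact: leq_trans (ltnW (allP wa b bw)) ac.
Qed.

(** When [a] is a record of [x], this prefix ends just before the next record; it is all of [x] if
    no letter exceeds [a]. *)
Definition upto a (x : seq nat) := take (find (ltn a) x) x.

Lemma upto_cat a u v :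
  upto a (u ++ v) = if has (ltn a) u then upto a u else u ++ upto a v.
Proof.
rewrite /upto find_cat; case: ifP => h; first by rewrite takel_cat ?find_size.
by rewrite take_cat ltnNge leq_addr /= addKn.
Qed.

Lemma upto_all a u : all (geq a) u -> upto a u = u.
Proof.
move=> h; rewrite -[in LHS](cats0 u) upto_cat cats0 ifN //.
by rewrite -all_predC; apply: sub_all h => b /=; rewrite -leqNgt.
Qed.

Lemma has_ltnN a u : ~~ has (ltn a) u = all (geq a) u.
Proof. by rewrite -all_predC; apply: eq_all => b /=; rewrite -leqNgt. Qed.

(* The labels of [W (baralpha x) i], read along the path, when [x] is a modified
   ascent sequence: see [labels_W]. *)
Definition wblock (x : seq nat) (i : nat) : seq nat :=
  let u := take (index i x) x in
  if all (gtn i) u then rlmax (upto i x) else [seq c <- rlmax u | c < i].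

Lemma wblockE u i v : i \notin u ->
  wblock (u ++ i :: v) i =
  if all (gtn i) u then rlmax (u ++ i :: upto i v) else [seq c <- rlmax u | c < i].
Proof.
move=> iu; rewrite /wblock index_cat (negbTE iu) /= eqxx addn0 take_size_cat //.
case: ifP => // h; rewrite upto_cat ifN ?has_ltnN; last first.
  by apply: sub_all h => b /ltnW.
by congr (rlmax (_ ++ _)); rewrite /upto /= ltnn.
Qed.

Lemma split_mem (i : nat) x : i \in x ->
  exists u v, x = u ++ i :: v /\ i \notin u.
Proof.
move=> ix; exists (take (index i x) x), (drop (index i x).+1 x); split.
  by rewrite -{1}(cat_take_drop (index i x) x) (drop_nth 0) ?index_mem ?nth_index.
by apply/negP => /(@index_ltn _); rewrite ltnn.
Qed.

(* [0] is below every letter, so that the first letter is always an ascent top. *)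
Definition nub_asctops (x : seq nat) : Prop :=
  all (ltn 0) x /\
  forall u a v, x = u ++ a :: v -> (last 0 u < a) = (a \notin u).

Lemma nub_asctops_prefix u v : nub_asctops (u ++ v) -> nub_asctops u.
Proof.
case; rewrite all_cat => /andP[h _] H; split=> // u1 a v1 E.
by apply: (H _ _ (v1 ++ v)); rewrite E -catA.
Qed.

Lemma take_index_lt (m : nat) u : all (geq m) u -> all (gtn m) (take (index m u) u).
Proof.
move=> h; apply/allP => b bu; have /= le := allP h b (mem_take bu).
rewrite /= ltn_neqAle le andbT.
apply: contraTneq bu => ->; apply/negP => /(@index_ltn _).
by rewrite ltnn.
Qed.

Lemma wblock_max u m : all (geq m) u -> wblock u m = rlmax u.
Proof. by move=> h; rewrite /wblock take_index_lt // upto_all. Qed.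

(** The block of [i] is settled once a letter larger than [i] has been read; until then [i] is the
    current maximum and its block is the whole stack. *)
Lemma wblock_cat u v i : i \in u ->
  wblock (u ++ v) i =
  if all (geq i) u then rlmax (u ++ upto i v) else wblock u i.
Proof.
move=> iu; rewrite /wblock index_cat iu takel_cat ?index_size // upto_cat -has_ltnN.
case: (boolP (has (ltn i) u)) => h //=.
by rewrite take_index_lt // -has_ltnN h.
Qed.

Lemma all_upto a x : all (geq a) (upto a x).
Proof.
by elim: x => //= b x; rewrite /upto /=; case: ltnP => //= ->.
Qed.

(** Up to the next record a record [i] stays on the stack, whereas the letters popped by [i] are
    strictly smaller than it. *)
Lemma mem_wblock x i : i \in x ->
  (i \in wblock x i) = all (gtn i) (take (index i x) x).
Proof.
case/split_mem => u [v [-> iu]]; rewrite wblockE //.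
rewrite index_cat (negbTE iu) /= eqxx addn0 take_size_cat //.
case: ifP => h; last by rewrite mem_filter ltnn.
rewrite rlmax_cat mem_cat /= ifT ?mem_head ?orbT //.
exact: all_upto.
Qed.

Lemma wblock_sub x i c : c \in wblock x i -> c \in x.
Proof.
rewrite /wblock; case: ifP => _ => [/mem_rlmax/mem_take//|].
by rewrite mem_filter => /andP[_ /mem_rlmax/mem_take].
Qed.

Lemma wblock_le x i c : c \in wblock x i -> c <= i.
Proof.
rewrite /wblock; case: ifP => _; last by rewrite mem_filter => /andP[/ltnW].
by move/mem_rlmax/(allP (all_upto i x)).
Qed.

Lemma sorted_wblock x i : sorted geq (wblock x i).
Proof.
rewrite /wblock; case: ifP => _; first exact: sorted_rlmax.
exact/sorted_filter/sorted_rlmax/geq_trans.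
Qed.

(** At its first occurrence a non-record [i] is an ascent top, so the letter just before it is on
    top of the stack and gets popped. *)
Lemma wblock_neq0 x i : nub_asctops x -> i \in x -> wblock x i != [::].
Proof.
move=> [_ hx] ix; case/split_mem: (ix) hx => u [v [E iu]] /(_ _ _ _ E).
rewrite iu => lu; rewrite E wblockE //; case: ifP => h.
  by rewrite rlmax_eq0; case: (u).
case/lastP: u iu lu h {E} => [|u c] // _; rewrite last_rcons => ci _.
by rewrite rlmax_rcons filter_rcons ci; case: filter.
Qed.

(** * Appending a last letter *)

Lemma maxs_ge x c : c \in x -> c <= maxs x.
Proof. by move=> cx; exact: leq_bigmax_seq. Qed.

Lemma all_maxs x : all (geq (maxs x)) x.
Proof. by apply/allP => c; exact: maxs_ge. Qed.

Lemma wblock_rcons_max q a i : i \in q -> all (gtn a) q ->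
  wblock (rcons q a) i = wblock q i.
Proof.
move=> iq aq; rewrite -cats1 wblock_cat //; case: ifP => // h.
by rewrite /upto /= (allP aq i iq : i < a) cats0 wblock_max.
Qed.

Lemma wblock_rcons q a i : i \in q -> ~~ all (gtn a) q ->
  wblock (rcons q a) i =
  if i == maxs q then rcons [seq c <- rlmax q | a <= c] a else wblock q i.
Proof.
move=> iq aq; have am : a <= maxs q.
  case/allPn: aq => c cq; rewrite -leqNgt => /leq_trans; apply; exact: maxs_ge.
have q0 : q != [::] by case: (q) iq.
rewrite -cats1 wblock_cat //; case: eqP => [->|ne].
  by rewrite all_maxs /upto /= ltnNge am /= cats1 rlmax_rcons.
rewrite ifN //; apply/negP => h; apply: ne; apply/eqP.
by rewrite eqn_leq maxs_ge //; exact: (allP h _ (maxs_mem q0)).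
Qed.

Lemma wblock_rcons_last q a : a \notin q ->
  wblock (rcons q a) a = if all (gtn a) q then [:: a] else [seq c <- rlmax q | c < a].
Proof.
move=> aq; rewrite -cats1 wblockE //; case: ifP => // h.
rewrite rlmax_cat /= (_ : [seq _ <- _ | _] = [::]) //.
apply: filter_nil => c /mem_rlmax cq /=.
by rewrite andbT -ltnNge; exact: (allP h).
Qed.

(** The stack is weakly decreasing, so the letters that [a] pops form its final segment. *)
Lemma rlmax_split a q :
  rlmax q = [seq d <- rlmax q | a <= d] ++ [seq d <- rlmax q | d < a].
Proof.
have := sorted_rlmax q; elim: (rlmax q) => //= d s IH sd.
have {IH} := IH (path_sorted sd); case: leqP => [_ {1}->//|da] _.
have ss := order_path_min geq_trans sd.
have -> : [seq d0 <- s | d0 < a] = s.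
  by apply/all_filterP; apply: sub_all ss => b /= /leq_ltn_trans; apply.
rewrite (_ : [seq _ <- s | _] = [::]) //.
apply/eqP; rewrite -[_ == _]negbK -has_filter -all_predC.
by apply: sub_all ss => b /= bd; rewrite -ltnNge (leq_ltn_trans bd).
Qed.

Lemma sum_update (r : seq nat) m (f g : nat -> nat) : uniq r -> m \in r ->
  {in r, forall i, i != m -> f i = g i} ->
  \sum_(i <- r) f i + g m = \sum_(i <- r) g i + f m.
Proof.
move=> ur mr fg; rewrite (bigD1_seq m) //= [in RHS](bigD1_seq m) //=.
suff -> : \sum_(i <- r | i != m) f i = \sum_(i <- r | i != m) g i by lia.
by rewrite big_seq_cond [RHS]big_seq_cond; apply: eq_bigr => i /andP[ir /fg->].
Qed.

Lemma nub_asctops_rcons q a : nub_asctops (rcons q a) -> nub_asctops q.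
Proof. by rewrite -cats1; exact: nub_asctops_prefix. Qed.

Lemma nub_asctops_rcons_last q a : nub_asctops (rcons q a) -> (last 0 q < a) = (a \notin q).
Proof. by case=> _ /(_ q a [::]); apply; rewrite cats1. Qed.

(* Reading from left to right, a letter that is not a new maximum joins the block
   of the maximum, after moving the smaller labels of it to its own block. *)
Lemma count_wblock x c : nub_asctops x ->
  count_mem c x = \sum_(i <- undup x) count_mem c (wblock x i).
Proof.
elim/last_ind: x => [|q a IH] hx; first by rewrite big_nil.
have {IH} E := IH (nub_asctops_rcons hx); rewrite -cats1 count_cat E /= addn0 cats1 {E}.
have la := nub_asctops_rcons_last hx.
have cF : count_mem c [seq d <- rlmax q | a <= d] +
    count_mem c [seq d <- rlmax q | d < a] = count_mem c (rlmax q).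
  by rewrite {3}(rlmax_split a q) count_cat.
(* When [a] is no record, only the block of [maxs q] changes: it was the whole stack, and it keeps
   the labels at least [a] and receives [a]. *)
have upd : ~~ all (gtn a) q ->
    \sum_(i <- undup q) count_mem c (wblock (rcons q a) i) + count_mem c (rlmax q) =
    \sum_(i <- undup q) count_mem c (wblock q i) +
    (count_mem c [seq d <- rlmax q | a <= d] + (a == c)).
  move=> nq; have mq : maxs q \in q by apply: maxs_mem; case: (q) nq.
  have -> : count_mem c [seq d <- rlmax q | a <= d] + (a == c) =
            count_mem c (wblock (rcons q a) (maxs q)).
    by rewrite wblock_rcons // eqxx -cats1 count_cat /= addn0.
  rewrite -[in LHS](wblock_max (all_maxs q)).
  apply: sum_update; rewrite ?undup_uniq ?mem_undup // => i.
  by rewrite mem_undup => iq /negbTE ne; rewrite wblock_rcons // ne.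
have [aq|aq] := boolP (a \in q).
  have -> : \sum_(i <- undup (rcons q a)) count_mem c (wblock (rcons q a) i) =
            \sum_(i <- undup q) count_mem c (wblock (rcons q a) i).
    apply: perm_big; apply: uniq_perm; rewrite ?undup_uniq // => i.
    by rewrite !mem_undup mem_rcons inE; case: eqP => // ->.
  have nq : ~~ all (gtn a) q by apply/allPn; exists a; rewrite //= ltnn.
  (* A repeated letter is not an ascent top, so it pops nothing. *)
  have := upd nq; suff -> : [seq d <- rlmax q | a <= d] = rlmax q.
    by rewrite (addnC (count_mem c _)) addnA => /addIn->.
  apply/all_filterP/allP => d /rlmax_ge.
  by apply: leq_trans; rewrite leqNgt la aq.
have -> : \sum_(i <- undup (rcons q a)) count_mem c (wblock (rcons q a) i) =
    count_mem c (wblock (rcons q a) a) +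
    \sum_(i <- undup q) count_mem c (wblock (rcons q a) i).
  rewrite -(big_cons _ _ _ _ xpredT (fun i => count_mem c (wblock _ i))).
  apply: perm_big; apply: uniq_perm; rewrite ?undup_uniq //=.
    by rewrite mem_undup aq undup_uniq.
  by move=> i; rewrite !inE !mem_undup mem_rcons inE.
(* A new letter takes the popped labels as its block, unless it is a record; then its block is [a]
   alone and the older blocks stay. *)
rewrite wblock_rcons_last //; case: ifP => [h|/negbT/upd U]; last first.
  apply: (@addnI (count_mem c [seq d <- rlmax q | a <= d])).
  by rewrite addnCA -U -cF addnC addnA.
rewrite /= addn0 addnC; congr (_ + _); rewrite big_seq [RHS]big_seq.
by apply: eq_bigr => i; rewrite mem_undup => iq; rewrite wblock_rcons_max.
Qed.

Lemma wblock_cover x c : nub_asctops x -> c \in x ->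
  exists2 i, i \in x & c \in wblock x i.
Proof.
move=> hx cx; have : 0 < count_mem c x by rewrite -has_count has_pred1.
rewrite (count_wblock _ hx) => h.
suff /hasP[i] : has (fun i => c \in wblock x i) (undup x).
  by rewrite mem_undup; exists i.
apply: contraLR h => /hasPn h; rewrite -leqNgt leqn0 sum_nat_seq_eq0.
by apply/allP => i /h ci; apply/implyP => _; apply/eqP/count_memPn.
Qed.

Lemma eq_maxs x y : x =i y -> maxs x = maxs y.
Proof.
move=> xy; apply/eqP; rewrite eqn_leq; apply/andP.
by split; apply/bigmax_leqP_seq => c cx _; apply: maxs_ge; rewrite ?xy // -xy.
Qed.

(** The last letter is the top of the final stack, which is the block of the maximum. Undoing that
    letter recovers the blocks of the shorter word, and induction applies. *)
Lemma wblock_inj x y : nub_asctops x -> nub_asctops y -> x =i y ->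
  {in x, forall i, wblock x i = wblock y i} -> x = y.
Proof.
elim/last_ind: x y => [|q a IH] y; case/lastP: y => [|q' a'] //.
- by move=> _ _ /(_ a'); rewrite mem_rcons mem_head.
- by move=> _ _ /(_ a); rewrite mem_rcons mem_head.
move=> hx hy xy wE.
have mE := eq_maxs xy.
have rE : rlmax (rcons q a) = rlmax (rcons q' a').
  rewrite -(wblock_max (all_maxs (rcons q a))) wE; first by rewrite mE wblock_max ?all_maxs.
  by apply: maxs_mem; case: (q).
have aE : a = a' by move/(congr1 (last 0)): rE; rewrite !last_rlmax !last_rcons.
subst a'; congr rcons.
(* The blocks determine all multiplicities, so removing the common last letter leaves words with the
   same letters. *)
have cE c : count_mem c (rcons q a) = count_mem c (rcons q' a).
  rewrite !count_wblock //.
  rewrite [RHS](perm_big (undup (rcons q a))) /=; last first.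
    by apply: uniq_perm; rewrite ?undup_uniq // => i; rewrite !mem_undup xy.
  by apply: eq_big_seq => i; rewrite mem_undup => /wE->.
have qE : q =i q'.
  move=> c; rewrite -[c \in q]has_pred1 -[c \in q']has_pred1 !has_count.
  by have := cE c; rewrite -!cats1 !count_cat => /addIn->.
apply: IH => // [||i iq]; try exact: nub_asctops_rcons hx; try exact: nub_asctops_rcons hy.
have iq' : i \in q' by rewrite -qE.
have := wE i; rewrite mem_rcons inE iq orbT => /(_ isT).
have aE : all (gtn a) q = all (gtn a) q' by exact: eq_all_r.
case/boolP: (all (gtn a) q) => aq.
  by rewrite !wblock_rcons_max // -aE.
rewrite !wblock_rcons -?aE // -(eq_maxs qE); case: eqP => // -> /rcons_inj[E1].
rewrite wblock_max ?all_maxs // (eq_maxs qE) wblock_max ?all_maxs //.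
rewrite (rlmax_split a q) (rlmax_split a q') E1; congr (_ ++ _).
(* The popped part of the old stack remains to be recovered: it is empty if [a] is repeated, and it
   is the block of [a] otherwise. *)
have [aq1|aq1] := boolP (a \in q).
  have nil p : nub_asctops (rcons p a) -> a \in p -> [seq d <- rlmax p | d < a] = [::].
    move=> /nub_asctops_rcons_last + ap; rewrite ap => /negbT; rewrite -leqNgt => la.
    apply/eqP; rewrite -[_ == _]negbK -has_filter -all_predC.
    apply/allP => d /rlmax_ge /=; rewrite -leqNgt; exact: leq_trans.
  by rewrite !nil // -qE.
have := wE a; rewrite mem_rcons mem_head => /(_ isT).
by rewrite !wblock_rcons_last -?qE // -aE (negbTE aq).
Qed.

(** * Block insertion *)

Lemma cat_eq_split (T : Type) (s t u v : seq T) a : s ++ t = u ++ a :: v ->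
  (exists2 v1, s = u ++ a :: v1 & v = v1 ++ t) \/
  (exists2 u1, u = s ++ u1 & t = u1 ++ a :: v).
Proof.
elim: s u => [|b s IH] [|c u] /=; [by right; exists [::]|by right; exists (c :: u)| |].
  by case=> -> <-; left; exists s.
case=> -> /IH[[v1 -> ->]|[u1 -> ->]]; first by left; exists v1.
by right; exists u1.
Qed.

Lemma mem_last_gt0 u : 0 < last 0 u -> last 0 u \in u.
Proof. by case/lastP: u => // u a; rewrite last_rcons mem_rcons mem_head. Qed.

(** A block that reads past [w] also reads the larger letter [j], which hides [w]. The last
    hypothesis prevents [w] from containing a new first occurrence of [i]. *)
Lemma wblock_insert u w j v i : all (gtn j) w -> j < last 0 u ->
  i \in u ++ j :: v -> i != j -> (i \in w -> i \in u) ->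
  wblock (u ++ w ++ j :: v) i = wblock (u ++ j :: v) i.
Proof.
move=> wj ju iz ij iw.
have [iu|iu] := boolP (i \in u).
  rewrite !wblock_cat //; case: ifP => // h.
  have ji : j < i.
    exact: leq_trans ju (allP h _ (mem_last_gt0 (leq_ltn_trans (leq0n j) ju))).
  rewrite upto_cat -if_neg has_ltnN ifT; last first.
    by apply: sub_all wj => b /= /ltn_trans/(_ ji)/ltnW.
  by rewrite /upto /= ltnNge (ltnW ji) /= rlmax_absorb.
have iv : i \in v by move: iz; rewrite mem_cat inE (negbTE iu) (negbTE ij).
have {}iw : i \notin w by apply: contra iu.
have [v1 [v2 [-> iv1]]] := split_mem iv.
rewrite -!cat_cons !catA !wblockE;
  try by rewrite !mem_cat !inE (negbTE iu) (negbTE ij) ?(negbTE iw).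
have -> : all (gtn i) ((u ++ w) ++ j :: v1) = all (gtn i) (u ++ j :: v1).
  rewrite !all_cat /=; case: (ltnP j i) => ji; last by rewrite !andbF.
  by rewrite (sub_all _ wj) ?andbT // => b /= /ltn_trans; apply.
by rewrite -!catA !cat_cons !rlmax_absorb.
Qed.

(** Every label on the stack of [u] is at least [last 0 u], hence at least [j], so [j] pops exactly
    [w], which is its own stack. *)
Lemma wblock_inserted u w j v : all (gtn j) w -> sorted geq w -> j <= last 0 u ->
  0 < j -> j \notin u -> wblock (u ++ w ++ j :: v) j = w.
Proof.
move=> wj sw ju j0 jnu.
have jw : j \notin w by apply/negP => /(allP wj) /=; rewrite ltnn.
have lu : last 0 u \in u by apply/mem_last_gt0/(leq_trans j0).
rewrite catA wblockE ?mem_cat ?negb_or ?jnu //.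
rewrite ifN; last by apply/allPn; exists (last 0 u); rewrite ?mem_cat ?lu //= -leqNgt.
rewrite rlmax_cat (rlmax_id sw) filter_cat -filter_predI.
rewrite [X in X ++ _](_ : _ = [::]); last first.
  apply: filter_nil => c /rlmax_ge /= cu.
  by rewrite ltnNge (leq_trans ju cu).
by apply/all_filterP; apply: sub_all wj.
Qed.

Lemma take_index_sub (T : eqType) (i : T) x u v : x = u ++ v -> i \notin u ->
  {subset u <= take (index i x) x}.
Proof.
move=> -> iu c cu; rewrite index_cat (negbTE iu) take_cat ltnNge leq_addr /=.
by rewrite mem_cat cu.
Qed.

Definition fishburn_blocks (k : nat) (w : nat -> seq nat) : Prop :=
  [/\ forall i, 1 <= i <= k -> w i != [::],
      forall i c, 1 <= i <= k -> c \in w i -> 1 <= c <= i,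
      forall c, 1 <= c <= k -> exists2 i, 1 <= i <= k & c \in w i
    & forall i, sorted geq (w i)].

(* [z] is the word obtained once the blocks of the labels at least [t] have been
   inserted; the other labels outside their own block are not yet ascent tops. *)
Definition partial_insertion k w t (z : seq nat) : Prop :=
  [/\ forall c, c \in z <->
        exists i, [/\ 1 <= i <= k, (i \in w i) || (t <= i) & c \in w i],
      forall u a v, z = u ++ a :: v ->
        (last 0 u < a) = (a \notin u) && ((a \in w a) || (t <= a)),
      forall i, i \in z -> (i \in wblock z i) = (i \in w i)
    & forall i, i \in z -> (i \in w i) || (t <= i) -> wblock z i = w i].

(** Each block used here starts with its own index, which is a new record, and has no ascent inside.
    The threshold [k.+1] is above all letters, so the alternative [t <= i] never applies. *)
Lemma insertion_start k w : fishburn_blocks k w ->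
  partial_insertion k w k.+1 (flatten [seq w i | i <- iota 1 k & i \in w i]).
Proof.
case=> _ wle _ ws.
pose z n := flatten [seq w i | i <- iota 1 n & i \in w i].
have zM n c : c \in z n <-> exists i, [/\ 1 <= i <= n, i \in w i & c \in w i].
  split=> [/flattenP[_ /mapP[i + ->] cw]|[i [hi iw cw]]].
    by rewrite mem_filter mem_iota add1n ltnS => /andP[iw hi]; exists i.
  by apply/flattenP; exists (w i) => //; apply: map_f; rewrite mem_filter iw mem_iota.
suff: forall n, n <= k ->
  [/\ forall u a v, z n = u ++ a :: v -> (last 0 u < a) = (a \notin u) && (a \in w a),
      forall i, i \in z n -> (i \in wblock (z n) i) = (i \in w i)
    & forall i, i \in z n -> i \in w i -> wblock (z n) i = w i].
  move=> /(_ k (leqnn k))[S R B].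
  have le c : c \in z k -> c <= k.
    by move=> /zM[i [hi iw cw]]; have := wle i c hi cw; lia.
  split=> [c|u a v E|//|i iz].
  - split=> [/zM[i [hi iw cw]]|[i [hi /orP[iw|] cw]]]; last by lia.
      by exists i; rewrite iw.
    by apply/zM; exists i.
  - rewrite (S u a v E) [k < a]ltnNge le ?orbF //.
    by rewrite /z E mem_cat mem_head orbT.
  - by case/orP=> [|]; [exact: B | rewrite ltnNge le].
elim=> [|n IH] nk; first by split=> // -[].
have [S R B] := IH (ltnW nk).
have zS : z n.+1 = z n ++ (if n.+1 \in w n.+1 then w n.+1 else [::]).
  rewrite /z -(addn1 n) iotaD filter_cat map_cat flatten_cat /= add1n addn1.
  by case: ifP => //= _; rewrite cats0.
case: ifP zS => [nw|_ ->]; last by rewrite cats0.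
have hn : 1 <= n.+1 <= k by lia.
have wle' c : c \in w n.+1 -> 1 <= c <= n.+1 := wle _ _ hn.
(* A weakly decreasing word that contains its upper bound [n.+1] begins with it. *)
have [r wE] : exists r, w n.+1 = n.+1 :: r.
  have := ws n.+1; case E: (w n.+1) nw => [|b r] // nw /= sb; exists r.
  have bn : b <= n.+1 by have := wle' b; rewrite E mem_head => /(_ isT); lia.
  move: nw; rewrite inE => /orP[/eqP<-//|nr].
  have nb : n.+1 <= b := allP (order_path_min geq_trans sb) _ nr.
  by congr cons; lia.
have zle c : c \in z n -> 1 <= c <= n.
  by case/zM=> i [hi _ cw]; have := wle i c; lia.
have nz : n.+1 \notin z n by apply/negP => /zle; lia.
have wz i : i \in z n -> wblock (z n ++ w n.+1) i = wblock (z n) i.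
  move=> iz; rewrite wblock_cat //; case: ifP => // h.
  by rewrite wE /upto /= ltnS (andP (zle i iz)).2 cats0 wblock_max.
have wn : wblock (z n ++ w n.+1) n.+1 = w n.+1.
  have az : all (gtn n.+1) (z n) by apply/allP => c /zle /=; lia.
  rewrite {1}wE wblockE // az upto_all; last first.
    by apply/allP => c cr; have := wle' c; rewrite wE inE cr orbT /=; lia.
  rewrite -wE rlmax_cat (rlmax_id (ws _)) (_ : [seq _ <- _ | _] = [::]) //.
  apply: filter_nil => c /mem_rlmax/(allP az) lt.
  by rewrite wE /= negb_and -ltnNge (lt : c < n.+1).
move=> ->; split.
- move=> u a v E0; case: (cat_eq_split E0) => [[v1 Ez _]|[u1 -> E]]; first exact: S Ez.
  case: u1 E => [|b u1]; rewrite wE => -[<- E].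
    rewrite cats0 nz wE mem_head; case/lastP: (z n) zle => // s c h.
    by rewrite last_rcons; have := h c; rewrite mem_rcons mem_head => /(_ isT); lia.
  have -> : (last 0 (z n ++ n.+1 :: u1) < a) = false.
    apply/negbTE; rewrite last_cat /= -leqNgt.
    have := ws n.+1; rewrite wE E /= cat_path /= => /and3P[_ h _]; exact: h.
  apply/esym/negbTE; rewrite negb_and negbK mem_cat inE.
  have aw : a \in w n.+1 by rewrite wE E !(inE, mem_cat) eqxx !orbT.
  have [->|an] := eqVneq a n.+1; first by rewrite orbT.
  (* A letter below [n.+1] that lies in its own block already occurs in [z n], along with that
     block. *)
  have [aa|] := boolP (a \in w a); last by rewrite orbT.
  by rewrite (_ : a \in z n) //; apply/zM; exists a; split=> //; have := wle' a aw; lia.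
- move=> i; rewrite mem_cat; case: (boolP (i \in z n)) => [iz _|iz /= iw].
    by rewrite wz ?R.
  have [->|ne] := eqVneq i n.+1; first by rewrite wn.
  have -> : i \in w i = false.
    apply: contraNF iz => ii; apply/zM; exists i; split=> //.
    by have := wle' i iw; lia.
  rewrite mem_wblock ?mem_cat ?iw ?orbT //; apply/negbTE/allPn; exists n.+1.
    rewrite wE; apply: (@take_index_sub _ i _ (z n ++ [:: n.+1]) r); rewrite -?catA //.
      by rewrite mem_cat negb_or iz inE.
    by rewrite mem_cat mem_head orbT.
  by have := wle' i iw; rewrite /= -leqNgt; lia.
- move=> i; rewrite mem_cat; case: (boolP (i \in z n)) => [iz _|iz /= iw] ii.
    by rewrite wz ?B.
  have [->|ne] := eqVneq i n.+1; first by rewrite wn.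
  case/negP: iz; apply/zM; exists i; split=> //; by have := wle' i iw; lia.
Qed.

(** If [t] lies in its own block, nothing is inserted and the thresholds [t] and [t.+1] agree.
    Otherwise the insertion turns the first [t] into an ascent top with block [w t], and leaves the
    other settled blocks alone. *)
Lemma insertion_step k w t z : fishburn_blocks k w -> 1 <= t <= k ->
  partial_insertion k w t.+1 z ->
  partial_insertion k w t (if t \in w t then z else insert_before t (w t) z).
Proof.
case=> wn wle wc ws ht [zM S R B]; case: ifPn => tw.
  have tE i : (i \in w i) || (t < i) = (i \in w i) || (t <= i).
    by rewrite (leq_eqVlt t i); case: eqP => // <-; rewrite tw.
  split=> // [c|u a v E|i iz]; [|by rewrite (S _ _ _ E) tE|by rewrite -tE; exact: B].
  by rewrite zM; split=> -[i]; exists i; rewrite ?tE // -tE.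
have wlt c : c \in w t -> 1 <= c < t.
  move=> cw; have := wle t c ht cw; rewrite (leq_eqVlt c) => /andP[->].
  by case: eqP cw tw => // -> ->.
have wt : all (gtn t) (w t) by apply/allP => c /wlt/andP[].
(* Some block contains [t]; its index is at least [t] and differs from [t], so this block is already
   part of [z]. *)
have tz : t \in z.
  have [i hi ti] := wc t ht; apply/zM; exists i; split=> //.
  have := wle i t hi ti; rewrite (leq_eqVlt t) => /andP[_ /orP[/eqP it|->]].
    by case/negP: tw; rewrite {2}it.
  by rewrite orbT.
have [u0 [v0 [Ez tu0]]] := split_mem tz.
have -> : insert_before t (w t) z = u0 ++ w t ++ t :: v0.
  rewrite /insert_before Ez index_cat (negbTE tu0) /= eqxx addn0.
  by rewrite take_size_cat // drop_size_cat.
(* The first [t] is not yet an ascent top, so the letter before it is at least [t], and it differs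
   from [t] by the choice of [u0]. *)
have lt_last : t < last 0 u0.
  have := S _ _ _ Ez; rewrite tu0 (negbTE tw) ltnn /= => /negbT.
  rewrite -leqNgt leq_eqVlt => /orP[/eqP E|//].
  by case/negP: tu0; rewrite E mem_last_gt0 // -E; case/andP: ht.
have lu0 : last 0 u0 \in u0 by apply/mem_last_gt0/(leq_ltn_trans (leq0n t)).
(* Such an [a] is a record of [z], so its first occurrence cannot follow the letter [last 0 u0],
   which exceeds [t] and hence [a]. *)
have old a : a \in w t -> a \in w a -> a \in u0.
  move=> aw aa; apply/negPn/negP => au.
  have ha := wlt a aw.
  have az : a \in z by apply/zM; exists a; rewrite aa; split=> //; lia.
  have := R a az; rewrite aa mem_wblock // => /allP/(_ (last 0 u0)).
  have -> : last 0 u0 \in take (index a z) z by apply: (take_index_sub Ez au).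
  by move=> /(_ isT) /=; lia.
have same a : (a \in u0) || (a \in t :: v0) -> a != t -> (a \in w t -> a \in u0) ->
    wblock (u0 ++ w t ++ t :: v0) a = wblock z a.
  by rewrite -mem_cat => az ne aw; rewrite Ez wblock_insert.
have inserted : wblock (u0 ++ w t ++ t :: v0) t = w t.
  by apply: wblock_inserted => //; [exact: ltnW | case/andP: ht].
split.
- move=> c; rewrite !mem_cat orbCA -mem_cat -Ez; split.
    case/orP=> [cw|/zM[i [hi h cw]]].
      by exists t; rewrite leqnn orbT.
    by exists i; split=> //; case/orP: h => [->|/ltnW->] //; rewrite orbT.
  case=> i [hi h cw]; have [it|it] := eqVneq i t; first by rewrite -it cw.
  apply/orP; right; apply/zM; exists i; split=> //.
  by case/orP: h => [->|h] //; rewrite orbC ltn_neqAle eq_sym it h.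
- move=> u a v E0; case: (cat_eq_split E0) => {E0} [[v1 E _]|[u1 -> {}E0]].
    rewrite (S u a (v1 ++ t :: v0)); last by rewrite Ez E -catA.
    have at_ : a != t by apply: contraNneq tu0 => <-; rewrite E mem_cat mem_head orbT.
    by rewrite (leq_eqVlt t) (eq_sym t) (negbTE at_).
  case: (cat_eq_split E0) => {E0} [[v1 E _]|[u2 -> E]].
    have aw : a \in w t by rewrite E mem_cat mem_head orbT.
    have -> : (last 0 (u0 ++ u1) < a) = false.
      apply/negbTE; rewrite -leqNgt; have := wlt a aw.
      case/lastP: u1 E => [|u1 b] E; first by rewrite cats0; lia.
      have := ws t; rewrite E last_cat last_rcons cat_rcons sorted_cat_cons.
      by case/andP=> _ /= /andP[].
    apply/esym/negbTE; rewrite !negb_and negb_or negbK mem_cat.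
    have [aa|aa] := boolP (a \in w a); first by rewrite old.
    by have := wlt a aw; rewrite orbC /=; lia.
  case: u2 E => [|b u2] /= [<- E].
    (* The first [t] is now preceded by the last letter of [w t], which is smaller than [t]. *)
    rewrite cats0 mem_cat (negbTE tu0) (negbTE tw) leqnn orbT.
    case/lastP: (w t) (wn t ht) wt => // s c _; rewrite last_cat last_rcons.
    by move=> /allP/(_ c); rewrite mem_rcons mem_head => /(_ isT) /= ->.
  rewrite !last_cat /=; have := S (u0 ++ t :: u2) a v.
  rewrite -catA /= -E => /(_ Ez); rewrite last_cat /= => ->.
  rewrite !mem_cat inE; have [at_|ne] := eqVneq a t.
    by rewrite !orbT.
  rewrite (leq_eqVlt t) (eq_sym t) (negbTE ne) !negb_or /=.
  case: (boolP (a \in w t)) => //= aw; rewrite !andbF /=.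
  have [aa|aa] := boolP (a \in w a); first by rewrite old.
  by rewrite orFb ltnNge; have := wlt a aw; case/andP => _ /ltnW->; rewrite !andbF.
- move=> i iz; have [->|it] := eqVneq i t; first by rewrite inserted.
  (* In the first case the first occurrence of [i] is now inside [w t], after the larger letter
     [last 0 u0], so [i] is not a record; by [old], it is not in its own block either. *)
  have [iw|iw] := boolP ((i \in w t) && (i \notin u0)).
    case/andP: iw => iw iu; rewrite mem_wblock //.
    have -> : i \in w i = false by apply: contraNF iu; exact: old.
    apply/negbTE/allPn; exists (last 0 u0); first exact: (take_index_sub erefl iu).
    by have := wlt i iw; rewrite /= -leqNgt; lia.
  rewrite negb_and negbK in iw.
  have iz0 : i \in z.
    move: iz; rewrite !mem_cat orbCA -mem_cat -Ez; case/orP: iw => [/negbTE-> //|iu _].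
    by rewrite Ez mem_cat iu.
  rewrite same ?R // -?mem_cat -?Ez //.
  by move=> h; move: iw; rewrite h.
- move=> i iz h; have [->|it] := eqVneq i t; first by [].
  have [iw|iw] := boolP ((i \in w t) && (i \notin u0)).
    case/andP: iw => iw iu; case/orP: h => [/(old _ iw)|]; first by rewrite (negbTE iu).
    by have := wlt i iw; lia.
  rewrite negb_and negbK in iw.
  have iz0 : i \in z.
    move: iz; rewrite !mem_cat orbCA -mem_cat -Ez; case/orP: iw => [/negbTE-> //|iu _].
    by rewrite Ez mem_cat iu.
  rewrite same -?mem_cat -?Ez //; last by move=> h'; move: iw; rewrite h'.
  by rewrite B //; case/orP: h => [->|h] //; rewrite orbC ltn_neqAle eq_sym it h.
Qed.

(** Here [n] counts the labels from [t] to [k]; [foldr] treats the largest of them first. *)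
Lemma insertion_end k w n t : fishburn_blocks k w -> 0 < t -> t + n = k.+1 ->
  partial_insertion k w t
    (foldr (fun j z => insert_before j (w j) z)
       (flatten [seq w i | i <- iota 1 k & i \in w i])
       [seq j <- iota t n | j \notin w j]).
Proof.
move=> hw; elim: n t => [|n IH] t t0 tn.
  by rewrite addn0 in tn; rewrite tn; exact: insertion_start.
have := insertion_step hw _ (IH t.+1 isT _); rewrite /= -if_neg.
by case: ifP => _ /= h; apply: h; lia.
Qed.

(** At threshold [1] every block is in place and every first occurrence is an ascent top. *)
Lemma alpha_spec P : fishburn_blocks (size P) (fun i => arrow (block P i)) ->
  [/\ nub_asctops (alpha P), forall c, (c \in alpha P) = (1 <= c <= size P)
    & forall i, 1 <= i <= size P -> wblock (alpha P) i = arrow (block P i)].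
Proof.
move=> hw; have [_ wle wc _] := hw.
have -> : alpha P = foldr (fun j z => insert_before j (arrow (block P j)) z)
    (flatten [seq arrow (block P i) | i <- iota 1 (size P) & i \in arrow (block P i)])
    [seq j <- iota 1 (size P) | j \notin arrow (block P j)].
  have eA i : (i \in arrow (block P i)) = (i \in block P i) by rewrite mem_sort.
  rewrite /alpha foldl_rev (eq_filter eA).
  by congr foldr; apply: eq_filter => i; rewrite eA.
have := insertion_end hw (ltn0Sn 0) (add1n (size P)).
set y := foldr _ _ _ => -[M S R B].
have yE c : (c \in y) = (1 <= c <= size P).
  apply/idP/idP => [/M[i [hi _ cw]]|hc]; first by have := wle i c hi cw; lia.
  have [i hi cw] := wc c hc; apply/M; exists i; split=> //.
  by case/andP: hi => ->; rewrite orbT.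
split=> // [|i hi]; last by apply: B; rewrite ?yE //; case/andP: hi => ->; rewrite orbT.
have y0 : all (ltn 0) y by apply/allP => c; rewrite yE => /andP[].
split=> // u a v E; rewrite (S u a v E).
have : a \in y by rewrite E mem_cat mem_head orbT.
by rewrite yE => /andP[-> _]; rewrite orbT andbT.
Qed.

(** * Trees *)

Definition word (T : tree) : seq nat := map (label T) (inorder T).

Lemma word_Node L a R : word (Node L a R) = word L ++ a :: word R.
Proof. by rewrite /word /= map_cat /= -!map_comp. Qed.

Lemma word_baralpha x : word (baralpha x) = x.
Proof.
move: {2}(size x) (leqnn (size x)) => n; elim: n x => [|n IH] x; first by case: x.
case: (x =P [::]) => [-> //|/eqP x0 hx]; rewrite baralphaE // word_Node.
have hm : index (maxs x) x < size x by rewrite index_mem maxs_mem.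
rewrite !IH; try by rewrite ?size_drop ?size_take ?hm; lia.
rewrite -[RHS](cat_take_drop (index (maxs x) x) x); congr (_ ++ _).
by rewrite [RHS](drop_nth 0) // nth_index // maxs_mem.
Qed.

Fixpoint endo (T : tree) : bool :=
  if T is Node L a R then
    [&& all (gtn a) (word L), all (geq a) (word R), endo L & endo R]
  else true.

Lemma endo_baralpha x : endo (baralpha x).
Proof.
move: {2}(size x) (leqnn (size x)) => n; elim: n x => [|n IH] x; first by case: x.
case: (x =P [::]) => [-> //|/eqP x0 hx]; rewrite baralphaE //=.
have hm : index (maxs x) x < size x by rewrite index_mem maxs_mem.
rewrite !word_baralpha take_index_lt ?all_maxs //=.
rewrite !IH; try by rewrite ?size_drop ?size_take ?hm; lia.
by rewrite !andbT; apply/allP => c /mem_drop; exact: maxs_ge.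
Qed.

(** The recursion follows the address [v], which suits induction on trees; [beforeE] relates it to
    in-order positions. *)
Fixpoint before (T : tree) (v : node) : seq nat :=
  match v, T with
  | [::], Node L _ _ => word L
  | false :: v', Node L _ _ => before L v'
  | true :: v', Node L a R => word L ++ a :: before R v'
  | _, Empty => [::]
  end.

Lemma beforeE T v : v \in inorder T ->
  before T v = take (index v (inorder T)) (word T).
Proof.
elim: T v => //= L IHL a R IHR v; rewrite word_Node.
have szL : size (word L) = size (inorder L) by rewrite size_map.
have inj c : injective (cons c : seq bool -> _) by move=> ? ? [].
have no (c d : bool) (w : node) s : c != d -> (c :: w \in map (cons d) s) = false.
  by move=> cd; apply/mapP => -[u _ [ecd _]]; rewrite ecd eqxx in cd.
rewrite mem_cat index_cat size_map; case: v => [|[] v].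
- move=> _; rewrite (_ : [::] \in _ = false) /= ?addn0 ?eqxx ?addn0.
    by rewrite take_size_cat.
  by apply/mapP => -[].
- rewrite no //= inE /= (mem_map (inj _)) => /IHR->.
  by rewrite (index_map (inj _)) take_cat szL ltnNge leq_addr /= addKn.
- rewrite (mem_map (inj _)) inE /= no // orbF => vL; rewrite vL (index_map (inj _)).
  by rewrite IHL // takel_cat // szL; apply/ltnW; rewrite index_mem.
Qed.

(** The root label exceeds the left labels and so pops them, and no label on the right pops the
    root. *)
Lemma labels_spine T : endo T ->
  [seq label T v | v <- spine true T] = rlmax (word T).
Proof.
elim: T => //= L _ a R IH /and4P[hL hR _ eR].
rewrite word_Node rlmax_cat /= hR -map_comp -(IH eR) /=.
rewrite (_ : [seq _ <- _ | _] = [::]) //.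
apply: filter_nil => c /mem_rlmax/(allP hL) ca.
by rewrite negb_and -ltnNge (ca : c < a).
Qed.

(** If [v] lies in the right subtree, the root label is at least that of [v] and pops the left
    labels, so what [v] pops comes from the right subtree alone. *)
Lemma labels_spine_left T v : endo T -> v \in inorder T ->
  [seq label T (rcons v false ++ u) | u <- spine true (subtree T (rcons v false))] =
  [seq c <- rlmax (before T v) | c < label T v].
Proof.
rewrite mem_inorder; elim: T v => [|L IHL a R IHR] [|b v] //= /and4P[hL hR eL eR].
  move=> _; rewrite /label /= -/(label L) (_ : subtree L [::] = L); last by case: (L).
  rewrite [LHS](labels_spine eL); apply/esym/all_filterP/allP => c /mem_rlmax.
  exact: (allP hL).
case: b => [vR|vL]; last exact: IHL.
rewrite [LHS](IHR _ eR vR) /label /= -/(label R v).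
have aR : label R v <= a.
  apply: (allP hR); apply: map_f; rewrite mem_inorder; exact: vR.
rewrite rlmax_cat filter_cat -filter_predI.
rewrite [X in X ++ _](_ : _ = [::]) /=.
  by case: ifP => //=; rewrite ltnNge aR.
apply: filter_nil => c /mem_rlmax/(allP hL) /=.
by move=> ca; rewrite (leqNgt a c) ca andbF.
Qed.

Lemma diagE T : diag T = spine false T.
Proof. by rewrite /diag /max_path /=; case: T => //= *; rewrite map_id. Qed.

(** A right step in the address puts before [v] an ancestor with label at least that of [v]; a
    diagonal node is preceded only by its left subtree, whose labels are smaller. *)
Lemma diag_record T v : endo T -> v \in inorder T ->
  (v \in diag T) = all (gtn (label T v)) (before T v).
Proof.
rewrite diagE mem_inorder; elim: T v => [|L IHL a R IHR] [|b v] //= /and4P[hL hR eL eR].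
  by rewrite mem_head hL.
rewrite inE /=; case: b => vT.
  rewrite all_cat /=; have aR : label R v <= a.
    by apply: (allP hR); apply: map_f; rewrite mem_inorder.
  rewrite /label /= -/(label R v) ltnNge aR andbF.
  by apply/mapP => -[].
by rewrite mem_map ?IHL // => ? ? [].
Qed.

(** The in-order word starts with the subtree of a diagonal node; the next letter, if any, is the
    label of its parent and is strictly larger, so [upto] cuts out that subtree. *)
Lemma labels_spine_diag T v : endo T -> v \in diag T ->
  [seq label T (v ++ u) | u <- spine true (subtree T v)] =
  rlmax (upto (label T v) (word T)).
Proof.
rewrite diagE; elim: T v => //= L IHL a R _ v eT; case/and4P: (eT) => hL hR eL eR.
rewrite inE => /orP[/eqP->|/mapP[u uL ->]].
  rewrite upto_all; first exact: (@labels_spine (Node L a R) eT).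
  rewrite word_Node /label /= all_cat /= leqnn hR !andbT.
  by apply: sub_all hL => c /ltnW.
rewrite [LHS](IHL _ eL uL) word_Node upto_cat /= -if_neg has_ltnN.
rewrite [label (Node _ _ _) _]/(label L u); case: ifP => // h.
have la : label L u < a.
  apply: (allP hL); apply: map_f; move: uL; rewrite spineE => /mapP[i + ->].
  by rewrite mem_iota mem_spine.
by rewrite upto_all // /upto /= la cats0.
Qed.

Lemma uniq_inorder T : uniq (inorder T).
Proof.
have inj c : injective (cons c : seq bool -> _) by move=> ? ? [].
elim: T => //= L uL a R uR; rewrite cat_uniq /= !(map_inj_uniq (inj _)) uL uR !andbT.
rewrite negb_or /= -andbA; apply/and3P; split; try by apply/negP; case/mapP.
by apply/hasPn => _ /mapP[u _ ->]; apply/negP; case/mapP.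
Qed.

Lemma asctop_spec T i : endo T -> nub_asctops (word T) -> i \in word T ->
  [/\ asctop T i \in inorder T, label T (asctop T i) = i
    & before T (asctop T i) = take (index i (word T)) (word T)].
Proof.
move=> eT mT iT; set n := index i (word T); set v := nth [::] (inorder T) n.
have hn : n < size (inorder T) by rewrite -(size_map (label T)) index_mem.
have vT : v \in inorder T by exact: mem_nth.
have lv : label T v = i by rewrite -(nth_map _ 0) // nth_index.
have bv : before T v = take n (word T) by rewrite beforeE // index_uniq ?uniq_inorder.
suff -> : asctop T i = v by [].
have wE : word T = take n (word T) ++ i :: drop n.+1 (word T).
  by rewrite -{1}(cat_take_drop n (word T)) (drop_nth 0) ?index_mem ?nth_index.
have iu : i \notin take n (word T) by apply/negP => /(@index_ltn _); rewrite ltnn.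
(* If [v] is not the first node, the letter before it is popped by [i], so the spine hanging from
   its left child is not empty. *)
have asc : (v == head [::] (inorder T)) || (rcons v false \in inorder T).
  case: (posnP n) => [n0|n_gt0]; first by rewrite /v n0 nth0 eqxx.
  case: mT => _ /(_ _ _ _ wE); rewrite iu => lt; apply/orP; right.
  have m : last 0 (take n (word T)) \in rlmax (take n (word T)).
    rewrite -last_rlmax; case E: (rlmax _) => [|b s]; last exact: mem_last.
    move/eqP: E; rewrite rlmax_eq0 -size_eq0 size_takel ?index_size //.
    by case: (n) n_gt0.
  have := labels_spine_left eT vT; rewrite mem_inorder lv bv; case: subtree => //= /esym/eqP.
  by rewrite -[_ == _]negbK -has_filter => /hasPn/(_ _ m); rewrite lt.
rewrite /asctop /asctops -filter_predI -[X in filter _ X](cat_take_drop n) filter_cat.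
rewrite (drop_nth [::] hn) -/v /= lv eqxx asc /= (_ : [seq _ <- _ | _] = [::]) //.
apply: filter_nil => u hu.
rewrite /= negb_and; apply/orP; left; apply: contra iu => /eqP <-.
by rewrite -map_take; apply: map_f.
Qed.

Lemma labels_W T i : endo T -> nub_asctops (word T) -> i \in word T ->
  [seq label T v | v <- W T i] = wblock (word T) i.
Proof.
move=> eT mT iT; have [vT lv bv] := asctop_spec eT mT iT.
rewrite /W /wblock -bv; move: (asctop T i) vT lv {bv} => v vT lv.
rewrite diag_record // lv; case: ifP => h.
  have vd : v \in diag T by rewrite diag_record // lv.
  rewrite -{1}lv -labels_spine_diag // /rpath /max_path.
  rewrite -[X in path_top _ X]cats0 -[X in _ ++ X]/(nseq 0 true) path_top_id -?map_comp //.
  (* A diagonal node is reached by left steps only, so it is no right child and its right path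
     starts there. *)
  move: vd; rewrite diagE spineE => /mapP[n _ ->] u.
  case/lastP: (nseq n false) (mem_nseq n false) => [_|s b /(_ b)]; first by case: u.
  by rewrite mem_rcons mem_head => /esym/andP[_ /eqP->] /rcons_inj[].
rewrite -{1}lv -labels_spine_left // /rpath /max_path.
rewrite -[X in path_top _ X]cats0 -[X in _ ++ X]/(nseq 0 true) path_top_id -?map_comp //.
by move=> u /rcons_inj[].
Qed.

(** * Modified ascent sequences *)

Lemma maxT_word T : maxT T = maxs (word T).
Proof. by rewrite /maxT /maxs big_map. Qed.

Lemma cayley_maxs x c : cayley x -> (c \in x) = (1 <= c <= maxs x).
Proof.
case=> k xk; rewrite xk; congr (_ && (_ <= _)); apply/eqP; rewrite eqn_leq.
apply/andP; split.
  by case: (posnP k) => [->//|k0]; apply: maxs_ge; rewrite xk k0 leqnn.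
by apply/bigmax_leqP_seq => b; rewrite xk => /andP[].
Qed.

Lemma mem_asctops_seq x i a : all (ltn 0) x ->
  ((i.+1, a) \in asctops_seq x) =
  [&& i < size x, nth 0 x i == a & last 0 (take i x) < a].
Proof.
move=> x0; have ascE : i < size x ->
    (i == 0) || (nth 0 x i.-1 < nth 0 x i) = (last 0 (take i x) < nth 0 x i).
  case: i => [|i] hi; first by rewrite take0 /=; apply/esym/(allP x0)/mem_nth.
  by rewrite (take_nth 0) ?last_rcons // ltnW.
apply/mapP/and3P => [[j]|[hi /eqP <- lt]].
  rewrite mem_filter mem_iota add0n /= => /andP[h hj] [ij ->]; move: h.
  by rewrite -ij in hj *; rewrite ascE.
by exists i; rewrite // mem_filter mem_iota hi ascE // lt.
Qed.

Lemma mem_nub_seq x i a :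
  ((i.+1, a) \in nub_seq x) = (1 <= a <= maxs x) && (index a x == i).
Proof.
apply/mapP/andP => [[b]|[ha /eqP <-]].
  by rewrite mem_iota => hb [-> ->]; rewrite eqxx; split=> //; lia.
by exists a; rewrite // mem_iota; lia.
Qed.

(** A pair at position [(size u).+1] is in [nub_seq] exactly when it marks a first occurrence, so
    the two sets of pairs are compared at each splitting [u ++ a :: v]. *)
Lemma modified_ascentP x : modified_ascent x <->
  nub_asctops x /\ forall c, (c \in x) = (1 <= c <= maxs x).
Proof.
have aux : (forall c, (c \in x) = (1 <= c <= maxs x)) -> all (ltn 0) x.
  by move=> xE; apply/allP => c; rewrite xE => /andP[].
split=> [[cx asc]|[[x0 asc] xE]].
  have xE c := cayley_maxs c cx; have x0 := aux xE; split=> //; split=> // u a v E.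
  have := asc ((size u).+1, a); rewrite mem_asctops_seq // mem_nub_seq -xE E.
  rewrite take_size_cat // nth_cat ltnn subnn eqxx size_cat /= -[X in X < _]addn0 ltn_add2l /=.
  move=> ->; rewrite mem_cat mem_head orbT /= index_cat.
  case: ifP => au; last by rewrite /= eqxx addn0 eqxx.
  by apply/negbTE; rewrite neq_ltn index_mem au.
split; first by exists (maxs x).
case=> -[|i] a; first by apply/mapP/mapP => -[].
rewrite mem_asctops_seq // mem_nub_seq -xE.
have [hi|hi] := ltnP i (size x); last first.
  apply/esym/negbTE; rewrite negb_and -index_mem; case: ltnP => //= ix.
  by rewrite neq_ltn (leq_trans ix hi).
case: eqP => /= [<-|ne].
  rewrite mem_nth //=.
  have E : x = take i x ++ nth 0 x i :: drop i.+1 x.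
    by rewrite -(drop_nth 0) // cat_take_drop.
  rewrite (asc _ _ _ E) {4}E index_cat size_takel ?(ltnW hi) //; case: ifP => au /=.
    by rewrite ltn_eqF // -[X in _ < X](size_takel (ltnW hi)) index_mem.
  by rewrite eqxx addn0 eqxx.
apply/esym/negbTE; rewrite negb_and; case: (boolP (a \in x)) => //= ax.
by apply: contra_notN ne => /eqP <-; rewrite nth_index.
Qed.

(** * Flips *)

Lemma sorted_geq_eq (s t : seq nat) : sorted geq s -> sorted geq t ->
  perm_eq s t -> s = t.
Proof.
by apply: sorted_eq; [exact: geq_trans | move=> a b /= h; apply/eqP; rewrite eqn_leq andbC].
Qed.

Lemma count_seq_mset (T : choiceType) (p : pred T) (s : seq T) :
  count p (seq_mset s) = count p s.
Proof. exact/permP/perm_eq_seq_mset. Qed.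

Lemma sorted_arrow B : sorted geq (arrow B).
Proof. by apply: sort_sorted => a b /=; exact: leq_total. Qed.

Lemma perm_arrow B : perm_eq (arrow B) B.
Proof. by rewrite perm_sort. Qed.

Lemma arrow_seq_mset s : sorted geq s -> arrow (seq_mset s) = s.
Proof.
move=> ss; apply: sorted_geq_eq (sorted_arrow _) ss _.
exact: perm_trans (perm_arrow _) (perm_eq_seq_mset _).
Qed.

(** With [k] the size of [P], these bounds keep [k.+1 - i] and [k.+1 - j] between [1] and [k], so
    that truncated subtraction acts as an involution. *)
Definition triangular (P : Defs.cover) : Prop :=
  forall i j, 1 <= i <= size P -> j \in arrow (block P i) -> 1 <= j <= i.

Lemma size_flip_cover P : size (flip_cover P) = size P.
Proof. by rewrite size_map size_iota. Qed.

Lemma count_columns P i j : 1 <= i <= size P ->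
  count_mem (i, j) (columns P) = count_mem j (arrow (block P i)).
Proof.
move=> hi; rewrite count_seq_mset count_flatten -map_comp sumnE big_map.
rewrite (bigD1_seq i) ?iota_uniq ?mem_iota //= count_map.
rewrite big1_seq ?addn0 => [|a /andP[ai _]].
  rewrite (permP (perm_arrow _)); apply: eq_count => b /=.
  by rewrite xpair_eqE eqxx.
rewrite count_map; apply/eqP; rewrite -leqn0 leqNgt -has_count; apply/hasPn => b _ /=.
by rewrite xpair_eqE (negbTE ai).
Qed.

Lemma mem_columns P c : c \in (columns P : seq (nat * nat)) ->
  1 <= c.1 <= size P /\ c.2 \in arrow (block P c.1).
Proof.
rewrite (perm_mem (perm_eq_seq_mset _)) => /flattenP[_ /mapP[i + ->] /mapP[j hj ->]].
by rewrite mem_iota add1n ltnS => hi; rewrite (perm_mem (perm_arrow _)).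
Qed.

Lemma count_flip_cover P i j : triangular P -> 1 <= i <= size P ->
  count_mem j (arrow (block (flip_cover P) i)) =
  if 1 <= j <= size P then
    count_mem ((size P).+1 - i) (arrow (block P ((size P).+1 - j)))
  else 0.
Proof.
move=> tP hi; have hi' : i.-1 < size P by lia.
rewrite (permP (perm_arrow _)) /block /flip_cover /cover_of_columns.
rewrite (nth_map 0) ?size_iota // nth_iota // add1n prednK; last by case/andP: hi.
rewrite count_seq_mset count_map count_filter count_seq_mset count_map -/(block P _).
(* The flip is inverted on columns: with [k] the size of [P], only the column with top [k.+1 - j]
   and bottom [k.+1 - i] is sent to [(i, j)]. *)
transitivity (count (predI (fun=> 1 <= j <= size P)
    (pred1 ((size P).+1 - j, (size P).+1 - i))) (columns P)).
  apply: eq_in_count => -[a b] /mem_columns[/= ha hb].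
  have := tP a b ha hb; rewrite xpair_eqE => h.
  by apply/idP/idP; lia.
case: ifP => hj; last exact: count_pred0.
by rewrite -count_columns //; lia.
Qed.

(** Indexing by [nat], with value [0] out of range, makes entries comparable between matrices whose
    sizes are only propositionally equal. *)
Definition entry (A : sqmatrix) (i j : nat) : nat :=
  match insub i, insub j with
  | Some i', Some j' => projT2 A i' j'
  | _, _ => 0
  end.

Lemma entryE A (i j : 'I_(projT1 A)) : entry A i j = projT2 A i j.
Proof. by rewrite /entry !valK. Qed.

Lemma sqmatrix_eqP (A B : sqmatrix) :
  A = B <-> projT1 A = projT1 B /\
    forall i j, i < projT1 A -> j < projT1 A -> entry A i j = entry B i j.
Proof.
split=> [->//|]; case: A B => [k A] [l B] /= [kl]; subst l => AB; congr existT.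
apply/matrixP => i j; have := AB i j (ltn_ord i) (ltn_ord j).
by rewrite (@entryE (existT _ k A) i j) (@entryE (existT _ k B) i j).
Qed.

Lemma entry_flip A i j : i < projT1 A -> j < projT1 A ->
  entry (flip_matrix A) i j = entry A (projT1 A - j.+1) (projT1 A - i.+1).
Proof.
move=> hi hj; rewrite (@entryE (flip_matrix A) (Ordinal hi) (Ordinal hj)) mxE.
by rewrite -(@entryE A (rev_ord (Ordinal hj)) (rev_ord (Ordinal hi))).
Qed.

Lemma maxT_baralpha x : maxT (baralpha x) = maxs x.
Proof. by rewrite maxT_word word_baralpha. Qed.

Lemma labels_W_baralpha x i : nub_asctops x -> i \in x ->
  [seq label (baralpha x) v | v <- W (baralpha x) i] = wblock x i.
Proof.
by move=> hx ix; rewrite labels_W ?word_baralpha //; exact: endo_baralpha.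
Qed.

Lemma entry_beta x i j : modified_ascent x -> i < maxs x -> j < maxs x ->
  entry (beta (baralpha x)) i j = count_mem j.+1 (wblock x i.+1).
Proof.
case/modified_ascentP => hx xE hi hj; rewrite -maxT_baralpha in hi hj.
rewrite (@entryE (beta (baralpha x)) (Ordinal hi) (Ordinal hj)) mxE.
rewrite -labels_W_baralpha //; first by rewrite count_map.
by rewrite xE -maxT_baralpha.
Qed.

(** Each matrix row counts the labels of one block. Matrix indices start at [0], whence [k - i.+1]
    in [entry_flip] against [k.+1 - i] here. *)
Lemma is_flipP x y : modified_ascent x ->
  is_flip x y <->
  [/\ modified_ascent y, maxs y = maxs x &
      forall i j, 1 <= i <= maxs x -> 1 <= j <= maxs x ->
        count_mem j (wblock y i) =
        count_mem ((maxs x).+1 - i) (wblock x ((maxs x).+1 - j))].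
Proof.
move=> hx; split=> [[hy /sqmatrix_eqP]|[hy yx H]].
  rewrite /= !maxT_baralpha => -[yx H]; split=> // -[|i] [|j] // hi hj.
  have := H i j; rewrite yx => /(_ hi hj).
  rewrite entry_flip /= ?maxT_baralpha // !entry_beta ?yx //; try by lia.
  move=> ->; congr (count_mem _ (wblock _ _)); lia.
split=> //; apply/sqmatrix_eqP; rewrite /= !maxT_baralpha yx; split=> // i j hi hj.
rewrite entry_flip /= ?maxT_baralpha // !entry_beta ?yx //; try by lia.
rewrite H //; congr (count_mem _ (wblock _ _)); lia.
Qed.

Lemma block_cover_of_tree x i : modified_ascent x -> 1 <= i <= maxs x ->
  arrow (block (cover_of_tree (baralpha x)) i) = wblock x i.
Proof.
move=> /modified_ascentP[hx xE] hi; have hi' : i.-1 < maxs x by lia.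
rewrite /block /cover_of_tree maxT_baralpha (nth_map 0) ?size_iota //.
rewrite nth_iota // add1n prednK; last by case/andP: hi.
by rewrite labels_W_baralpha ?xE // arrow_seq_mset // sorted_wblock.
Qed.

(** The flip exchanges two conditions: its blocks are nonempty because every label of [x] lies in
    some block, and they contain every label because the blocks of [x] are nonempty. *)
Lemma fishburn_flip x : modified_ascent x ->
  fishburn_blocks (maxs x)
    (fun i => arrow (block (flip_cover (cover_of_tree (baralpha x))) i)) /\
  forall i j, 1 <= i <= maxs x -> 1 <= j <= maxs x ->
    count_mem j (arrow (block (flip_cover (cover_of_tree (baralpha x))) i)) =
    count_mem ((maxs x).+1 - i) (wblock x ((maxs x).+1 - j)).
Proof.
move=> hx; set P := cover_of_tree _; have [mx xE] := (modified_ascentP x).1 hx.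
have sP : size P = maxs x by rewrite size_map size_iota maxT_baralpha.
have bP i : 1 <= i <= maxs x -> arrow (block P i) = wblock x i.
  exact: block_cover_of_tree.
have xle i j : j \in wblock x i -> 1 <= j <= i.
  move=> ji; rewrite (wblock_le ji) andbT.
  by have := wblock_sub ji; rewrite xE => /andP[].
have tP : triangular P by move=> i j; rewrite sP => hi; rewrite bP //; exact: xle.
have cE i j : 1 <= i <= maxs x ->
    count_mem j (arrow (block (flip_cover P) i)) =
    if 1 <= j <= maxs x then
      count_mem ((maxs x).+1 - i) (wblock x ((maxs x).+1 - j)) else 0.
  move=> hi; rewrite count_flip_cover ?sP //; case: ifP => // hj.
  by rewrite bP //; lia.
have mE i j : 1 <= i <= maxs x -> (j \in arrow (block (flip_cover P) i)) =
    (1 <= j <= maxs x) && ((maxs x).+1 - i \in wblock x ((maxs x).+1 - j)).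
  move=> hi; rewrite -[LHS]has_pred1 -[X in _ && X]has_pred1 !has_count cE //.
  by case: ifP.
split; last by move=> i j hi hj; rewrite cE // hj.
split=> [i hi|i j hi|j hj|i]; last exact: sorted_arrow.
- have : (maxs x).+1 - i \in x by rewrite xE; lia.
  case/(wblock_cover mx) => j; rewrite xE => hj ij.
  have := mE i ((maxs x).+1 - j) hi; rewrite subKn ?ij ?andbT; last by lia.
  by case: arrow => // /esym; rewrite in_nil; lia.
- by rewrite mE // => /andP[hj /xle]; lia.
- have jx : (maxs x).+1 - j \in x by rewrite xE; lia.
  have := wblock_neq0 mx jx; case E: (wblock _ _) => [//|b s] _.
  have bj : b \in wblock x ((maxs x).+1 - j) by rewrite E mem_head.
  have := xle _ _ bj => hb; exists ((maxs x).+1 - b); first by lia.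
  by rewrite mE ?subKn ?bj ?hj //; lia.
Qed.

Theorem mainTheorem6 (x : seq nat) (hx : modified_ascent x) (hx0 : x != [::])
    (y : seq nat) :
  is_flip x y <-> y = alpha (flip_cover (cover_of_tree (baralpha x))).
Proof.
have [hw wE] := fishburn_flip hx; have [_ xE] := (modified_ascentP x).1 hx.
set Q := flip_cover _ in hw wE *.
have sQ : size Q = maxs x by rewrite size_flip_cover size_map size_iota maxT_baralpha.
have [] : [/\ nub_asctops (alpha Q), forall c, (c \in alpha Q) = (1 <= c <= size Q)
    & forall i, 1 <= i <= size Q -> wblock (alpha Q) i = arrow (block Q i)].
  by apply: alpha_spec; rewrite sQ.
rewrite sQ => mQ memQ bQ; have [_ wle _ _] := hw.
apply: (iff_trans (is_flipP y hx)); split=> [[hy yx H]|->].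
  have [my yE] := (modified_ascentP y).1 hy.
  apply: wblock_inj => // [c|i]; first by rewrite yE memQ yx.
  rewrite yE yx => hi; rewrite bQ //.
  (* Weakly decreasing words with equal multiplicities coincide, and only labels between [1] and
     [maxs x] can occur in either. *)
  apply: sorted_geq_eq (sorted_wblock _ _) (sorted_arrow _) _.
  apply/allP => j; rewrite mem_cat => hj; apply/eqP.
  have hj1 : 1 <= j <= maxs x.
    case/orP: hj => [/wblock_sub|/(wle _ _ hi)]; last by lia.
    by rewrite yE yx.
  by rewrite /= H ?wE.
have mx : maxs (alpha Q) = maxs x by apply: eq_maxs => c; rewrite memQ xE.
split=> //; last by move=> i j hi hj; rewrite bQ // wE.
by apply/modified_ascentP; split=> // c; rewrite memQ mx.
Qed.
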